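(* A meander (with at least one vertex) is Frobenius if and only if its signature contains no component elimination move $C_0(c)$ (for any $c$) except the very last move, which must be $C_0(1)$.
   Context: Meanders. Let $n$ be a positive integer and let $(a_1,\ldots,a_k)$ and $(b_1,\ldots,b_m)$ be two ordered sequences of positive integers, each with sum $n$. The meander of type $\frac{a_1|a_2|\cdots|a_k}{b_1|b_2|\cdots|b_m}$ is the (multi)graph on vertices $v_1,\ldots,v_n$ placed left to right on a line, constructed as follows. Split $v_1,\ldots,v_n$ into consecutive top blocks of sizes $a_1,\ldots,a_k$, and also into consecutive bottom blocks of sizes $b_1,\ldots,b_m$. For each top block, with vertices $v_p,\ldots,v_q$, add the top edges $v_{p+i}v_{q-i}$ for all $i\ge 0$ with $p+i<q-i$. For each bottom block add bottom edges in the same way. A pair of vertices joined by both a top edge and a bottom edge forms a cycle. Every connected component is a path (possibly a single vertex) or a cycle. The index of the meander is $2C+P-1$, where $C$ is the number of cycles and $P$ the number of paths. The meander is Frobenius if its index is $0$. Signature. To a nonempty meander of type $\frac{a_1|a_2|\cdots|a_k}{b_1|b_2|\cdots|b_m}$ exactly one of the following moves applies, producing a new (possibly empty) meander: (1) Flip $F_0$: if $a_1<b_1$, replace it by $\frac{b_1|b_2|\cdots|b_m}{a_1|a_2|\cdots|a_k}$. (2) Component elimination $C_0(c)$: if $a_1=b_1=c$, replace it by $\frac{a_2|a_3|\cdots|a_k}{b_2|b_3|\cdots|b_m}$. (3) Block elimination $B_0$: if $a_1=2b_1$, replace it by $\frac{b_1|a_2|a_3|\cdots|a_k}{b_2|b_3|\cdots|b_m}$.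 (4) Rotation contraction $R_0$: if $b_1<a_1<2b_1$, replace it by $\frac{b_1|a_2|a_3|\cdots|a_k}{(2b_1-a_1)|b_2|b_3|\cdots|b_m}$. (5) Pure contraction $P_0$: if $a_1>2b_1$, replace it by $\frac{(a_1-2b_1)|b_1|a_2|a_3|\cdots|a_k}{b_2|b_3|\cdots|b_m}$. The signature of a meander is the uniquely determined sequence of moves obtained by repeatedly applying the applicable move until the empty meander is reached. *)

(* Defs.v *)
From HB Require Import structures.
From mathcomp Require Import all_boot all_order all_algebra.
From mathcomp Require Import zify.

Set Implicit Arguments.
Unset Strict Implicit.
Unset Printing Implicit Defensive.

(* A multigraph on a finite vertex type T is given by its edge-multiplicity
   function mult : T -> T -> nat, assumed symmetric. *)
Section Multigraph.
Variables (T : finType) (mult : T -> T -> nat).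

Definition adjacent : rel T := [rel x y | 0 < mult x y].

Definition components : {set {set T}} :=
  equivalence_partition (connect adjacent) [set: T].

(* E lists the edges of the sub-multigraph induced on S: every unordered pair
   {x, y} occurs in E, in either orientation, exactly as often as it is joined
   by an edge. *)
Definition edges_listed_by (S : {set T}) (E : seq (T * T)) : bool :=
  [forall x in S, forall y in S,
     mult x y == count (fun e => (e == (x, y)) || (e == (y, x))) E].

(* The pairs in zip s (behead s) are (s_0, s_1), ..., (s_(k-2), s_(k-1)); a
   single isolated vertex is a path. *)
Definition is_path (S : {set T}) : bool :=
  [exists s : #|S|.-tuple T,
     [&& uniq s, S == [set x in s] & edges_listed_by S (zip s (behead s))]].

(* The pairs in zip s (rot 1 s) also include the closing pair (s_(k-1), s_0).
   For k = 2 this lists the same unordered pair twice, so that two vertices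
   form a cycle exactly when they are joined by a double edge; for k = 1 it
   lists a loop. *)
Definition is_cycle (S : {set T}) : bool :=
  [exists s : #|S|.-tuple T,
     [&& uniq s, S == [set x in s] & edges_listed_by S (zip s (rot 1 s))]].

Definition num_cycles : nat := #|[set S in components | is_cycle S]|.
Definition num_paths : nat := #|[set S in components | is_path S]|.

End Multigraph.

Definition is_composition (n : nat) (a : seq nat) : bool :=
  all (leq 1) a && (sumn a == n).

(* Vertices are numbered from 0, so the block of index j of the composition a
   is the interval p, ..., q below. *)
Definition arc (a : seq nat) (x y : nat) : bool :=
  [exists j : 'I_(size a),
     let p := sumn (take j a) in
     let q := (p + nth 0 a j).-1 in
     [exists i : 'I_(nth 0 a j),
        [&& x == p + i, y == q - i & p + i < q - i]]].

Definition block_edge (a : seq nat) (x y : nat) : bool := arc a x y || arc a y x.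

Definition meander_graph (n : nat) (a b : seq nat) (x y : 'I_n) : nat :=
  block_edge a x y + block_edge b x y.

Definition meander_index (n : nat) (a b : seq nat) : int :=
  let C := num_cycles (@meander_graph n a b) in
  let P := num_paths (@meander_graph n a b) in
  (2 * C%:Z + P%:Z - 1)%R.

Definition frobenius (n : nat) (a b : seq nat) : Prop := meander_index n a b = 0%R.

Inductive move : Type :=
  | F0
  | C0 of nat
  | B0
  | R0
  | P0.

Definition is_C0 (mv : move) : bool := if mv is C0 _ then true else false.

(* step a b mv a' b': the move mv applies to the type a / b and replaces it by
   the type a' / b'. *)
Inductive step : seq nat -> seq nat -> move -> seq nat -> seq nat -> Prop :=
  | step_F0 a1 a b1 b : a1 < b1 ->
      step (a1 :: a) (b1 :: b) F0 (b1 :: b) (a1 :: a)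
  | step_C0 c a1 a b1 b : a1 = c -> b1 = c ->
      step (a1 :: a) (b1 :: b) (C0 c) a b
  | step_B0 a1 a b1 b : a1 = 2 * b1 ->
      step (a1 :: a) (b1 :: b) B0 (b1 :: a) b
  | step_R0 a1 a b1 b : b1 < a1 < 2 * b1 ->
      step (a1 :: a) (b1 :: b) R0 (b1 :: a) (2 * b1 - a1 :: b)
  | step_P0 a1 a b1 b : 2 * b1 < a1 ->
      step (a1 :: a) (b1 :: b) P0 (a1 - 2 * b1 :: b1 :: a) b.

Inductive signature : seq nat -> seq nat -> seq move -> Prop :=
  | signature_empty : signature [::] [::] [::]
  | signature_step a b mv a' b' s :
      step a b mv a' b' -> signature a' b' s -> signature a b (mv :: s).

Lemma step_fun n a b mv1 a1 b1 mv2 a2 b2 :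
    is_composition n a -> is_composition n b ->
    step a b mv1 a1 b1 -> step a b mv2 a2 b2 ->
  [/\ mv1 = mv2, a1 = a2 & b1 = b2].
Proof.
move=> ca cb st1 st2; move: ca cb.
case: st1 st2 => [x xs y ys|c x xs y ys|x xs y ys|x xs y ys|x xs y ys] h;
  [|move=> h'|..] => st2;
  inversion st2; subst; rewrite /is_composition /= => /andP[/andP[]] ? ? ?
    /andP[/andP[]] ? ? ?; split=> //; lia.
Qed.

(* A flip preserves the number of vertices, but is never followed by a flip. *)
Definition step_measure (n : nat) (a b : seq nat) : nat :=
  2 * n + (head 0 a < head 0 b).

Lemma step_composition n a b mv a' b' :
    is_composition n a -> is_composition n b -> step a b mv a' b' ->
  exists n', [/\ is_composition n' a', is_composition n' b' &
                 step_measure n' a' b' < step_measure n a b].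
Proof.
move=> ca cb st; exists (sumn a'); move: ca cb.
rewrite /step_measure.
case: st => [x xs y ys|c x xs y ys|x xs y ys|x xs y ys|x xs y ys] h;
  [|move=> h'|..]; rewrite /is_composition /=;
  move=> /andP[/andP[? ->]] ? /andP[/andP[? ->]] ?; rewrite ?andbT;
  split; lia.
Qed.

Lemma step_exists n a b :
    0 < n -> is_composition n a -> is_composition n b ->
  exists mv a' b', step a b mv a' b'.
Proof.
case: a => [|x xs]; first by rewrite /is_composition /=; lia.
case: b => [|y ys]; first by rewrite /is_composition /=; lia.
move=> _ _ _; case: (ltngtP x y) => [xy|yx|xy].
- by do 3 eexists; apply: step_F0.
- case: (ltngtP x (2 * y)) => [lt|gt|e].
  + by do 3 eexists; apply: step_R0; rewrite yx.
  + by do 3 eexists; apply: step_P0.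
  + by do 3 eexists; apply: step_B0.
- by do 3 eexists; apply: (@step_C0 y).
Qed.

Lemma signature_exists n a b :
  is_composition n a -> is_composition n b -> exists s, signature a b s.
Proof.
have [k] := ubnP (step_measure n a b).
elim: k n a b => // k IHk n a b lek ca cb.
have [n0|n_gt0] := posnP n.
  exists [::]; case: a b ca cb {lek} => [|x xs] [|y ys];
    rewrite /is_composition /= n0; try lia; constructor.
have [mv [a' [b' st]]] := step_exists n_gt0 ca cb.
have [n' [ca' cb' lt]] := step_composition ca cb st.
have [|s sig] := IHk n' a' b' _ ca' cb'; first by move: lt lek; lia.
by exists (mv :: s); apply: signature_step st sig.
Qed.

Lemma signature_unique n a b s1 s2 :
    is_composition n a -> is_composition n b ->
  signature a b s1 -> signature a b s2 -> s1 = s2.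
Proof.
move=> ca cb sig1; elim: sig1 n s2 ca cb => {a b s1} [|a b mv a' b' s st _ IH].
  by move=> n s2 _ _ sig2; inversion sig2 as [|? ? ? ? ? ? st_nil]; first by []; inversion st_nil.
move=> n s2 ca cb sig2; inversion sig2 as [|? ? mv2 a2 b2 s3 st2 sig3]; subst.
  by inversion st.
have [emv ea eb] := step_fun ca cb st st2; subst.
have [n' [ca' cb' _]] := step_composition ca cb st.
by rewrite (IH _ _ ca' cb' sig3).
Qed.

(* Main.v *)
(* Let T and B be the involutions reversing every top block and every bottom
   block. The vertices of a path form a single orbit of f = B o T, those of a
   cycle split into two orbits, so the meander is Frobenius exactly when f has a
   single orbit. A flip conjugates f to its inverse, and B0, R0 and P0 delete an
   initial segment of the vertices and replace f by the first-return map to the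
   remaining ones; all these moves preserve having a single orbit. On a common
   first block of size c the map f is the identity, so at a move C0(c) there is
   a single orbit only if c = 1 and nothing else is left. *)

Require Import Defs.
From mathcomp Require Import all_boot all_order all_algebra.
From mathcomp Require Import zify.

Set Implicit Arguments.
Unset Strict Implicit.
Unset Printing Implicit Defensive.

(** * Graphs generated by two involutions *)

Section InvolutionPair.
Variables (V : finType) (mult : V -> V -> nat) (T B : V -> V).
Hypotheses (TK : involutive T) (BK : involutive B).
Hypothesis multE : forall x y,
  mult x y = ((x != y) && (T x == y)) + ((x != y) && (B x == y)).

Local Notation f := (B \o T).

Lemma involutions_comp_inj : injective f.
Proof. exact: inj_comp (inv_inj BK) (inv_inj TK). Qed.

Lemma iter_comp_inj k : injective (iter k f).
Proof. by elim: k => //= k IH; apply: inj_comp involutions_comp_inj IH. Qed.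

(** [T] conjugates [f] to its inverse [T \o B], so the [k] steps taken after the reflection undo the
    [k] steps taken before it. *)
Lemma iter_comp_refl k x : iter k f (T (iter k f x)) = T x.
Proof.
elim: k x => // k IH x.
by rewrite [X in T X]/= iterSr /= TK BK IH.
Qed.

Lemma fconnect_refl x y : fconnect f x y -> fconnect f (T x) (T y).
Proof.
move=> /iter_findex <-; rewrite (fconnect_sym involutions_comp_inj).
have := fconnect_iter f (findex f x y) (T (iter (findex f x y) f x)).
by rewrite iter_comp_refl.
Qed.

Lemma connectE x y :
  connect (adjacent mult) x y = fconnect f x y || fconnect f x (T y).
Proof.
have adjT z : connect (adjacent mult) z (T z).
  have [e|ne] := eqVneq z (T z); first by rewrite -e.
  by apply: connect1; rewrite /adjacent /= multE ne eqxx.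
have adjB z : connect (adjacent mult) z (B z).
  have [e|ne] := eqVneq z (B z); first by rewrite -e.
  by apply: connect1; rewrite /adjacent /= multE ne eqxx addnC.
have sub z : fconnect f x z -> connect (adjacent mult) x z.
  apply: connect_sub => u v /eqP <-.
  exact: connect_trans (adjT u) (adjB _).
apply/idP/orP; last first.
  case=> /sub // h; apply: connect_trans h _.
  by rewrite -{2}[y]TK.
(* [D] is closed under both involutions, because [B z = f (T z)] and [f (T (B z)) = z]. *)
pose D := [pred z | fconnect f x z || fconnect f x (T z)].
have cl z t : adjacent mult z t -> D z -> D t.
  rewrite /adjacent /= multE addn_gt0 !lt0b.
  move=> /orP[] /andP[_ /eqP <-] /orP[] h; rewrite ?TK ?h ?orbT //.
    apply/orP; right; apply: connect_trans h _.
    by rewrite (fconnect_sym involutions_comp_inj); apply: connect1; rewrite /= TK BK.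
  apply/orP; left; apply: connect_trans h _.
  by apply: connect1; rewrite /= TK.
have Dpath p t : path (adjacent mult) t p -> D t -> D (last t p).
  elim: p t => // z p IH t /= /andP[tz pz] Dt.
  by apply: IH pz _; apply: cl tz Dt.
by case/connectP=> p pp ->; apply/orP; apply: Dpath pp _; rewrite /= connect0.
Qed.

Definition component x := [set y | connect (adjacent mult) x y].

Lemma in_components S :
  reflect (exists x, S = component x) (S \in components mult).
Proof.
apply: (iffP imsetP) => [[x _ ->]|[x ->]]; exists x => //;
  by apply/setP => y; rewrite !inE.
Qed.

Lemma component_eq x y : connect (adjacent mult) x y -> component x = component y.
Proof.
have sym : symmetric (adjacent mult).
  move=> u v; rewrite /adjacent /= !multE [v == u]eq_sym.
  by rewrite (inv_eq TK) (inv_eq BK) [T v == u]eq_sym [B v == u]eq_sym.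
move=> xy; apply/setP=> z; rewrite !inE.
by rewrite (same_connect (sym_connect_sym sym) xy).
Qed.

(** Closed form of the walk that follows [T] and [B] alternately, starting with [T]. *)
Definition walk x k := if odd k then T (iter k./2 f x) else iter k./2 f x.

Lemma walkS x k : walk x k.+1 = (if odd k then B else T) (walk x k).
Proof.
by rewrite /walk /= uphalf_half; case: (odd k).
Qed.

(** * Sequences alternating between the two involutions *)

Section Walk.
Variables (w : nat -> V) (m : nat).
Hypothesis wS : forall k, w k.+1 = (if odd k then B else T) (w k).
Hypothesis w_inj : {in gtn m &, injective w}.

Lemma walk_eq i j : i < m -> j < m -> (w i == w j) = (i == j).
Proof. by move=> im jm; apply: (inj_in_eq w_inj). Qed.

(** Each involution undoes its own step, so the neighbours of [w i] are its successor and its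
    predecessor; at [i = 0] the vertex [B (w 0)] stands in for the latter. *)
Lemma mult_walk i y : mult (w i) y = ((w i != y) && (w i.+1 == y)) +
  ((w i != y) && ((if i is i'.+1 then w i' else B (w 0)) == y)).
Proof.
case: i => [|i]; first by rewrite wS multE.
have e : w i = (if odd i then B else T) (w i.+1).
  by rewrite wS; case: odd; rewrite ?BK ?TK.
by rewrite e (wS i.+1) multE /=; case: (odd i) => //=; rewrite addnC.
Qed.

Lemma uniq_walk : uniq (mkseq w m).
Proof.
by rewrite map_inj_in_uniq ?iota_uniq // => i j; rewrite !mem_iota; apply: w_inj.
Qed.

(** By injectivity a listed pair can match only at [k = i] or [k = j], and [w i != w j] keeps the
    two matches from sharing an index. The bound [l <= m] admits the closing pair of a cycle. *)
Lemma count_walk l i j : i < m -> j < m -> l <= m -> w i != w j ->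
  count (fun e => (e == (w i, w j)) || (e == (w j, w i)))
    [seq (w k, w k.+1) | k <- iota 0 l] =
  ((i < l) && (w i.+1 == w j)) + ((j < l) && (w j.+1 == w i)).
Proof.
move=> im jm lm ne; rewrite count_map.
pose p i j := fun k => (w i.+1 == w j) && (k == i).
have cp i' j' : count (p i' j') (iota 0 l) = (i' < l) && (w i'.+1 == w j').
  rewrite andbC /p; case: (w _ == _) => /=; last by rewrite count_pred0.
  by rewrite (eq_count (a2 := pred1 i')) // count_uniq_mem ?iota_uniq ?mem_iota.
rewrite -!cp -count_predUI [X in _ + X](_ : _ = 0) ?addn0; last first.
  apply/eqP; rewrite -leqn0 leqNgt -has_count; apply/hasPn => k; rewrite mem_iota => kl.
  by apply: contra ne => /andP[/andP[_ /eqP <-] /andP[_ /eqP <-]].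
apply: eq_in_count => k; rewrite mem_iota /p /= => kl.
have km : k < m by lia.
rewrite !xpair_eqE !(walk_eq km) //; congr (_ || _); rewrite andbC.
  by have [->|] := eqVneq k i; rewrite ?andbF.
by have [->|] := eqVneq k j; rewrite ?andbF.
Qed.

Lemma count_walk_diag l i : i < m -> l < m \/ l = m /\ 1 < m /\ w m = w 0 ->
  count (fun e => (e == (w i, w i)) || (e == (w i, w i)))
    [seq (w k, w k.+1) | k <- iota 0 l] = 0.
Proof.
move=> im lm; apply/eqP; rewrite -leqn0 leqNgt -has_count has_map.
apply/hasPn => k; rewrite mem_iota /= orbb xpair_eqE => kl.
apply/negP => /andP[/eqP <- ].
have [km|mk] := ltnP k.+1 m; first by rewrite walk_eq; lia.
case: lm => [|[lm [m1 wm]]]; first by lia.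
have -> : k.+1 = m by lia.
by rewrite wm walk_eq; lia.
Qed.

(** The walk starts and stalls at fixed points, so neither end has an edge beyond the [m.-1] listed
    ones. *)
Lemma is_path_walk (S : {set V}) : 0 < m -> S = [set y in mkseq w m] ->
  B (w 0) = w 0 -> w m = w m.-1 -> is_path mult S.
Proof.
move=> m0 SE B0 wm.
have uw := uniq_walk.
have szS : size (mkseq w m) == #|S|.
  by rewrite SE cardsE (card_uniqP uw).
apply/existsP; exists (Tuple szS); apply/and3P; split=> //=; first exact/eqP.
have -> : zip (mkseq w m) (behead (mkseq w m)) = [seq (w k, w k.+1) | k <- iota 0 m.-1].
  apply: (@eq_from_nth _ (w 0, w 0)) => [|k].
    by rewrite size_zip size_behead !size_map !size_iota; lia.
  rewrite size_zip size_behead !size_map !size_iota => kl.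
  have kl' : k < m.-1 by lia.
  by rewrite nth_zip_cond ifT ?size_zip ?size_behead ?size_map ?size_iota //
     nth_behead !nth_mkseq ?(nth_map 0) ?size_iota ?nth_iota ?add0n //; lia.
apply/forall_inP => x; rewrite SE inE => /mapP[i]; rewrite mem_iota => im ->.
apply/forall_inP => y; rewrite inE => /mapP[j]; rewrite mem_iota => jm ->.
have [e|ne] := eqVneq (w i) (w j).
  by rewrite -e count_walk_diag ?mult_walk ?eqxx //; left; lia.
rewrite count_walk //; last by lia.
rewrite mult_walk ne /=; apply/eqP; congr (nat_of_bool _ + nat_of_bool _).
  have [//|mi] := ltnP i m.-1; have -> : i.+1 = m by lia.
  by rewrite wm (_ : m.-1 = i) ?(negbTE ne) //; lia.
case: i im ne => [|i] im ne.
  rewrite B0 (negbTE ne); have [jm1|//] := ltnP j m.-1.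
  by rewrite walk_eq; lia.
have [jm1|mj] := ltnP j m.-1; first by rewrite !walk_eq; lia.
by rewrite walk_eq; lia.
Qed.

Lemma is_cycle_walk (S : {set V}) : 1 < m -> ~~ odd m ->
  S = [set y in mkseq w m] -> w m = w 0 -> is_cycle mult S.
Proof.
move=> m1 evm SE wm.
have uw := uniq_walk.
have szS : size (mkseq w m) == #|S|.
  by rewrite SE cardsE (card_uniqP uw).
apply/existsP; exists (Tuple szS); apply/and3P; split=> //=; first exact/eqP.
(* Since [w m = w 0], the closing pair is just the entry [k = m.-1]. *)
have -> : zip (mkseq w m) (rot 1 (mkseq w m)) = [seq (w k, w k.+1) | k <- iota 0 m].
  apply: (@eq_from_nth _ (w 0, w 0)) => [|k].
    by rewrite size_zip size_rot !size_map !size_iota minnn.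
  rewrite size_zip size_rot !size_map !size_iota minnn => km.
  rewrite nth_zip ?size_rot // nth_mkseq // (nth_map 0) ?size_iota // nth_iota //.
  congr (_, _); rewrite -[m in mkseq w m](prednK (ltnW m1)) /mkseq /= rot1_cons.
  rewrite nth_rcons size_map size_iota; case: ltnP => km1.
    by rewrite (nth_map 0) ?size_iota // nth_iota.
  by rewrite (_ : k.+1 = m) ?wm ?if_same //; lia.
apply/forall_inP => x; rewrite SE inE => /mapP[i]; rewrite mem_iota => im ->.
apply/forall_inP => y; rewrite inE => /mapP[j]; rewrite mem_iota => jm ->.
have [e|ne] := eqVneq (w i) (w j).
  by rewrite -e count_walk_diag ?mult_walk ?eqxx //; right.
(* As [m.-1] is odd, the closing step is a [B] step, which provides the missing predecessor of
   [w 0]. *)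
have Bw0 : B (w 0) = w m.-1.
  rewrite -wm -[in LHS](prednK (ltnW m1)) wS ifT ?BK //.
  by lia.
rewrite count_walk // mult_walk ne /=; apply/eqP.
rewrite !add0n /= in im jm.
congr (nat_of_bool _ + nat_of_bool _); first by rewrite im.
rewrite jm /=; case: i im {ne} => [|i] im.
  rewrite Bw0; have [jm1|mj] := ltnP j.+1 m; first by rewrite !walk_eq; lia.
  by rewrite (_ : j.+1 = m) ?wm ?walk_eq; lia.
have [jm1|mj] := ltnP j.+1 m; first by rewrite !walk_eq; lia.
by rewrite (_ : j.+1 = m) ?wm ?walk_eq; lia.
Qed.
End Walk.

(** Degree count: a vertex fixed by [T] or [B] has degree at most 1, whereas in a cyclic listing
    every vertex occurs once as a first and once as a second entry, which gives degree 2. *)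
Lemma not_is_cycle x : T x = x \/ B x = x -> ~~ is_cycle mult (component x).
Proof.
move=> fix_x; set S := component x.
have xS : x \in S by rewrite inE connect0.
clearbody S.
have deg_le : \sum_(y in S) mult x y <= 1.
  have le1 (g : V -> V) : \sum_(y in S) ((x != y) && (g x == y) : nat) <= (g x != x).
    have [e|ne] := eqVneq (g x) x.
      by rewrite big1 // => y _; rewrite e andNb.
    rewrite (big_mkcond) (bigD1 (g x)) //= big1 ?addn0 => [|y /negbTE ny].
      by case: ifP => // _; apply: leq_b1.
    by rewrite [g x == y]eq_sym ny andbF if_same.
  under eq_bigr do rewrite multE.
  rewrite big_split /=.
  by apply: leq_trans (leq_add (le1 T) (le1 B)) _; case: fix_x => ->;
    rewrite eqxx; case: (_ != _).
apply/negP => /existsP[[s szs] /= /and3P[us /eqP Ss /forall_inP lst]].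
have SE y : (y \in S) = (y \in s) by move/setP: (Ss) => /(_ y); rewrite in_set.
suff : \sum_(y in S) mult x y = 2 by lia.
set E := zip _ _ in lst.
have E1 : map fst E = s by rewrite -/unzip1 unzip1_zip ?size_rot.
have E2 : map snd E = rot 1 s by rewrite -/unzip2 unzip2_zip ?size_rot.
have ES e : e \in E -> (e.1 \in S) && (e.2 \in S).
  move=> eE; rewrite !SE -{1}E1 map_f //=.
  by rewrite -(mem_rot 1) -E2 map_f.
have multS u v : u \in S -> v \in S ->
    mult u v = count (fun e => (e == (u, v)) || (e == (v, u))) E.
  by move=> uS vS; move/forall_inP: (lst u uS) => /(_ v vS) /eqP.
have noloop e : e \in E -> e.1 != e.2.
  case: e => u v eE /=; apply/eqP => uv; subst v.
  have /andP[uS _] := ES _ eE; have := multS u u uS uS.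
  rewrite multE eqxx /= => /esym/eqP; rewrite -leqn0 leqNgt -has_count => /negP[].
  by apply/hasP; exists (u, u); rewrite ?eqxx.
have countE (p : pred (V * V)) : count p E = \sum_(e <- E) p e.
  by rewrite -sum1_count big_mkcond; apply: eq_bigr => e _; case: (p e).
rewrite (eq_bigr _ (fun y yS => multS x y xS yS)).
under eq_bigr do rewrite countE.
(* Double counting: no listed pair is a loop, so each contributes one for every entry equal to
   [x]. *)
rewrite exchange_big /= (eq_big_seq (fun e : V * V => (e.1 == x) + (e.2 == x))).
  have c1 : count (fun e => e.1 == x) E = 1.
    by rewrite -(count_map fst (pred1 x)) E1 count_uniq_mem -?SE ?xS.
  have c2 : count (fun e => e.2 == x) E = 1.
    rewrite -(count_map snd (pred1 x)) E2 count_uniq_mem ?rot_uniq //.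
    by rewrite mem_rot -SE xS.
  by rewrite big_split /= -(countE (fun e => e.1 == x)) -(countE (fun e => e.2 == x)) c1 c2.
case=> u v eE; have /andP[/= uS vS] := ES _ eE; have /= uv := noloop _ eE.
under eq_bigr do rewrite !xpair_eqE.
have [eu|nu] := eqVneq u x.
  have vx : (v == x) = false by rewrite -eu eq_sym (negbTE uv).
  rewrite vx (bigD1 v) //= eqxx andbF big1 // => y /andP[_ /negbTE ny].
  by rewrite [v == y]eq_sym ny andbF.
have [ev|nv] := eqVneq v x.
  rewrite (bigD1 u) //= eqxx big1 // => y /andP[_ /negbTE ny].
  by rewrite [u == y]eq_sym ny.
by rewrite big1 // => y _; rewrite andbF.
Qed.

(* Starting at an endpoint, the path is traversed by alternating T and B; in
   terms of f its vertices are f^0 x, f^(-1) x, f^1 x, f^(-2) x, and so on. *)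
Lemma is_path_component x : B x = x -> is_path mult (component x).
Proof.
move=> Bx; set m := order f x.
have m0 : 0 < m by apply: order_gt0.
have fm : iter m f x = x by apply: iter_order; apply: involutions_comp_inj.
(* From [B x = x] follows [T x = f^(-1) x], so [T] sends [f^i x] to [f^(-1-i) x], with exponents
   modulo the orbit length [m]. *)
have Titer i : i < m -> T (iter i f x) = iter (m.-1 - i) f x.
  move=> im; apply: (@iter_comp_inj i.+1).
  rewrite -iterD (_ : i.+1 + (m.-1 - i) = m) ?fm; last by lia.
  by rewrite iterS iter_comp_refl /= TK Bx.
pose ex k := if odd k then m.-1 - k./2 else k./2.
have walkE k : k <= m -> walk x k = iter (ex k) f x.
  by move=> km; rewrite /walk /ex; case: ifP => // ok; rewrite Titer //; lia.
have exm k : k <= m -> ex k < m.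
  by rewrite /ex; case: ifP => ok km; lia.
have winj : {in gtn m &, injective (walk x)}.
  move=> i j; rewrite !unfold_in /= => im jm; rewrite !walkE ?(ltnW im) ?(ltnW jm) //.
  move=> /(congr1 (findex f x)); rewrite !findex_iter ?exm ?(ltnW im) ?(ltnW jm) //.
  by rewrite /ex; case: ifP; case: ifP; lia.
(* [T x] lies in the orbit of [x], so the two orbits making up the component coincide. *)
have compE : component x = [set y | fconnect f x y].
  apply/setP=> y; rewrite !inE connectE; apply/orb_idr => /fconnect_refl.
  rewrite TK; apply: connect_trans.
  by rewrite -[T x]/(T (iter 0 f x)) Titer // fconnect_iter.
apply: (is_path_walk (walkS x) winj) => //; last first.
  by rewrite !walkE ?leq_pred // /ex; congr (iter _ _ _); do 2 case: ifP; lia.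
(* The walk lists [m] distinct vertices inside an orbit of size [m], hence all of it. *)
rewrite compE; apply/esym/eqP; rewrite eqEcard; apply/andP; split.
  apply/subsetP=> y; rewrite !inE => /mapP[k]; rewrite mem_iota /= => km ->.
  by rewrite walkE ?fconnect_iter //; lia.
by rewrite !cardsE (card_uniqP (uniq_walk winj)) size_mkseq.
Qed.

(** The component consists of two disjoint orbits of equal size [o]; the walk visits them
    alternately and closes after [o.*2] steps. *)
Lemma is_cycle_component x : ~~ fconnect f x (T x) -> is_cycle mult (component x).
Proof.
move=> NTx; set o := order f x.
have o0 : 0 < o by apply: order_gt0.
have fo : iter o f x = x by apply: iter_order; apply: involutions_comp_inj.
have Nrefl i j : iter i f x <> T (iter j f x).
  move=> e; move: NTx; rewrite -(iter_comp_refl j x) -e -iterD.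
  by rewrite fconnect_iter.
have iter_eq i j : i < o -> j < o -> iter i f x = iter j f x -> i = j.
  by move=> io jo /(congr1 (findex f x)); rewrite !findex_iter.
have winj : {in gtn o.*2 &, injective (walk x)}.
  move=> i j; rewrite !unfold_in /= => im jm; rewrite /walk.
  case: ifP => oi; case: ifP => oj.
  - by move=> /(inv_inj TK) /iter_eq h; have := h; lia.
  - by move=> /esym /Nrefl.
  - by move=> /Nrefl.
  - by move=> /iter_eq h; have := h; lia.
apply: (is_cycle_walk (walkS x) winj); try by [rewrite odd_double|lia].
  apply/setP=> y; rewrite !inE connectE; apply/idP/mapP.
    case/orP=> h; have := iter_findex h; have := findex_max h; rewrite -/o.
      set k := findex _ _ _ => ko e; exists k.*2; first by rewrite mem_iota; lia.
      by rewrite /walk odd_double doubleK e.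
    set k := findex _ _ _ => ko e; exists k.*2.+1; first by rewrite mem_iota; lia.
    by rewrite /walk /= odd_double uphalf_double e TK.
  case=> k _ ->; rewrite /walk; case: ifP => _; last by rewrite fconnect_iter.
  by rewrite TK fconnect_iter orbT.
by rewrite /walk odd_double doubleK fo.
Qed.

(** If [T x = f^j x], the reflection [T] has its centre halfway along this stretch: for even [j] the
    midpoint is fixed by [T], for odd [j] the point just past the middle is fixed by [B]. *)
Lemma fconnect_refl_fixed x : fconnect f x (T x) ->
  exists2 u, connect (adjacent mult) x u & T u = u \/ B u = u.
Proof.
move=> h; have := iter_findex h; set j := findex _ _ _; clearbody j => Tx.
exists (iter (uphalf j) f x); first by rewrite connectE fconnect_iter.
have : T (iter (uphalf j) f x) = iter j./2 f x.
  apply: (@iter_comp_inj (uphalf j)).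
  by rewrite iter_comp_refl -Tx -iterD; congr (iter _ _ _); lia.
rewrite uphalf_half; case: (odd j) => /= h2; last by left.
by right; rewrite -{1}h2 TK.
Qed.

End InvolutionPair.

(** A component where [T x] leaves the orbit of [x] is a cycle. Without cycles every component is a
    single orbit containing a fixed point, hence a path, and counting paths counts orbits. The point
    [x0] rules out the empty graph, which has no path. *)
Lemma unique_path_component_iff (V : finType) (mult : V -> V -> nat) (T B : V -> V)
    (x0 : V) : involutive T -> involutive B ->
    (forall x y, mult x y =
       ((x != y) && (T x == y)) + ((x != y) && (B x == y))) ->
  (num_cycles mult = 0 /\ num_paths mult = 1) <->
  (forall x y, fconnect (B \o T) x y).
Proof.
move=> TK BK multE.
(* Exchanging [T] and [B] reduces an endpoint fixed by [T] to one fixed by [B]. *)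
have multE' x y : mult x y = ((x != y) && (B x == y)) + ((x != y) && (T x == y)).
  by rewrite addnC.
have comp_mem x : component mult x \in components mult by apply/in_components; exists x.
have path_fixed x : T x = x \/ B x = x -> is_path mult (component mult x).
  case=> e; first exact: is_path_component BK TK multE' _ e.
  exact: is_path_component TK BK multE _ e.
split=> [[/eqP C0 /eqP P1] x y|tr].
  have refl z : fconnect (B \o T) z (T z).
    apply: contraTT C0 => /(is_cycle_component TK BK multE) cyc.
    rewrite -lt0n; apply/card_gt0P; exists (component mult z).
    by rewrite inE comp_mem.
  have paths z : component mult z \in [set S in components mult | is_path mult S].
    rewrite inE comp_mem /=.
    have [u zu fu] := fconnect_refl_fixed TK BK multE (refl z).
    by rewrite (component_eq TK BK multE zu) path_fixed.
  have /cards1P[S ES] := P1.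
  have : y \in component mult x.
    have := paths x; have := paths y; rewrite ES !in_set1 => /eqP ey /eqP ->.
    by rewrite -ey inE connect0.
  rewrite inE (connectE TK BK multE) => /orP[//|h].
  apply: connect_trans h _; rewrite (fconnect_sym (involutions_comp_inj TK BK)).
  exact: refl.
have compT x : component mult x = setT.
  by apply/setP=> y; rewrite !inE (connectE TK BK multE) tr.
have compsE : components mult = [set setT].
  apply/setP=> S; rewrite inE; apply/in_components/eqP => [[x ->]|->] //.
  by exists x0.
have [u _ fu] := fconnect_refl_fixed TK BK multE (tr x0 (T x0)).
rewrite /num_cycles /num_paths compsE; split.
  apply/eqP; rewrite cards_eq0; apply/eqP/setP=> S; rewrite !inE.
  have [->|//] := eqVneq S setT.
  by rewrite -(compT u) (negbTE (not_is_cycle multE fu)).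
apply/eqP/cards1P; exists setT; apply/setP=> S; rewrite !inE.
by have [->|//] := eqVneq S setT; rewrite -(compT u) path_fixed.
Qed.

(** * Block reversals and signature moves *)

(** Beyond the last block it is the identity, which makes it an involution on all of [nat]. *)
Fixpoint block_rev (a : seq nat) (x : nat) : nat :=
  if a is c :: a' then
    if x < c then c.-1 - x else c + block_rev a' (x - c)
  else x.

Lemma block_rev_head c a x : x < c -> block_rev (c :: a) x = c.-1 - x.
Proof. by rewrite /= => ->. Qed.

Lemma block_rev_tail c a x :
  c <= x -> block_rev (c :: a) x = c + block_rev a (x - c).
Proof. by rewrite /= ltnNge => ->. Qed.

Lemma block_revK a : involutive (block_rev a).
Proof.
elim: a => [|c a IH] x //=; case: (ltnP x c) => xc.
  by rewrite ifT; lia.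
by rewrite ifF ?addKn ?IH; lia.
Qed.

Lemma block_rev_lt a x : x < sumn a -> block_rev a x < sumn a.
Proof.
elim: a x => [|c a IH] x //=; case: (ltnP x c) => xc xs; first by lia.
by rewrite ltn_add2l IH //; lia.
Qed.

(** Reversing a block exchanges [p + i] with [q - i], and [x < y] selects the left end of the arc;
    both directions peel off the first block. *)
Lemma arcP a x y : reflect (x < y /\ block_rev a x = y) (Defs.arc a x y).
Proof.
apply: (iffP idP).
  case/existsP=> -[j lt_j] /= /existsP[[i lt_i] /= /and3P[/eqP-> /eqP-> lt]].
  split=> //; clear x y; move: lt; elim: a j lt_j lt_i => [|c a IH] [|j] //=.
    by move=> _ ic; rewrite !add0n ic.
  rewrite ltnS => lt_j lt_i lt.
  rewrite ifF; last by lia.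
  have -> : c + sumn (take j a) + i - c = sumn (take j a) + i by lia.
  by rewrite IH //; lia.
case; elim: a x y => [|c a IH] x y /=; first by lia.
case: (ltnP x c) => xc xy e; subst y.
  by apply/existsP; exists ord0; apply/existsP; exists (Ordinal xc) => /=; lia.
have lt : x - c < block_rev a (x - c) by lia.
case/existsP: (IH _ _ lt erefl) => j.
case/existsP=> i /and3P[/eqP ex /eqP ey lt'].
apply/existsP; exists (lift ord0 j); apply/existsP; exists i => /=.
by case: i ex ey lt' => i lt_i /=; rewrite !add0n; lia.
Qed.

Lemma block_edgeE a x y : block_edge a x y = (x != y) && (block_rev a x == y).
Proof.
apply/orP/andP.
  case=> /arcP[lt e]; first by rewrite e; split; lia.
  by rewrite -e block_revK; split; lia.
case=> ne /eqP e; case: (ltngtP x y) => [lt|lt|exy].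
- by left; apply/arcP.
- by right; apply/arcP; split; rewrite // -e block_revK.
- by rewrite exy eqxx in ne.
Qed.

(** * Single orbits and first-return maps *)

Definition one_orbit (n : nat) (f : nat -> nat) : Prop :=
  forall x y, x < n -> y < n -> exists k, iter k f x = y.

(** [g] is the first-return map of [f] to the vertices from [d] on, renumbered from 0. An excursion
    below [d] lasts one step, and surjectivity onto the deleted segment makes its points
    reachable. *)
Lemma one_orbit_first_return d n f g :
    (forall x, x < d + n -> f x < d + n) ->
    (forall x, x < d -> d <= f x) ->
    (forall x, x < n -> f (d + x) = d + g x \/
       f (d + x) < d /\ f (f (d + x)) = d + g x) ->
    (forall x, x < d -> exists2 y, y < d + n & f y = x) ->
  one_orbit (d + n) f <-> one_orbit n g.
Proof.
move=> fn fd fg fsurj; split=> H x y xn yn.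
  have [||k] := H (d + x) (d + y); rewrite ?ltn_add2l //.
  (* Strong induction on the number of [f] steps, as one [g] step absorbs one or two of them. *)
  have [l] := ubnP k; elim: l k x xn => // l IH k x xn lk.
  have gn : g x < n.
    have lt : d + x < d + n by rewrite ltn_add2l.
    by case: (fg x xn) => [|[_]] e; rewrite -(ltn_add2l d) -e !fn.
  case: k lk => [|k] lk; first by move=> /= e; exists 0 => /=; lia.
  rewrite iterSr; case: (fg x xn) => [-> e|[lt e]].
    by have [|q <-] := IH k (g x) gn _ e; [lia | exists q.+1; rewrite iterSr].
  (* The path cannot stop during the excursion, since its end [d + y] is not below [d]. *)
  case: k lk => [|k] lk; first by move=> /= e'; lia.
  rewrite iterSr e => e'.
  by have [|q <-] := IH k (g x) gn _ e'; [lia | exists q.+1; rewrite iterSr].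
have up z t : z < n -> t < n -> exists k, iter k f (d + z) = d + t.
  move=> zn tn; have [k <-] := H z t zn tn => {tn}; elim: k z zn => [|k IH] z zn.
    by exists 0.
  have gn : g z < n.
    have lt : d + z < d + n by rewrite ltn_add2l.
    by case: (fg z zn) => [|[_]] e; rewrite -(ltn_add2l d) -e !fn.
  rewrite iterSr; have [q <-] := IH _ gn; case: (fg z zn) => [e|[_ e]].
    by exists q.+1; rewrite iterSr e.
  by exists q.+2; rewrite !iterSr e.
(* Every vertex is at most one step before a surviving vertex and at most one step after one. *)
have from_x : exists k, d <= iter k f x < d + n.
  by case: (leqP d x) => xd; [exists 0; rewrite /= xd | exists 1; rewrite /= fd //= fn].
have to_y : exists k z, d <= z < d + n /\ iter k f z = y.
  case: (leqP d y) => yd; first by exists 0, y; rewrite yd.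
  have [z zn e] := fsurj y yd; exists 1, z; split => //=.
  by rewrite zn andbT leqNgt; apply/negP => /fd; rewrite e; lia.
have {from_x} [k1 h1] := from_x; have {to_y} [k2 [z [h2 <-]]] := to_y.
have [||k] := up (iter k1 f x - d) (z - d); try lia.
have [-> ->] : d + (iter k1 f x - d) = iter k1 f x /\ d + (z - d) = z by lia.
by move=> e; exists (k2 + (k + k1)); rewrite !iterD e.
Qed.

(** * Meander maps under the moves *)

Definition meander_map (a b : seq nat) (x : nat) : nat :=
  block_rev b (block_rev a x).

Lemma meander_map_lt n a b x : is_composition n a -> is_composition n b ->
  x < n -> meander_map a b x < n.
Proof.
move=> /andP[_ /eqP ea] /andP[_ /eqP eb] xn.
by rewrite -eb block_rev_lt // eb -ea block_rev_lt // ea.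
Qed.

Lemma meander_mapK a b : cancel (meander_map a b) (meander_map b a).
Proof. by move=> x; rewrite /meander_map !block_revK. Qed.

(** Conjugation by [block_rev a] turns one composite into the other. *)
Lemma one_orbit_flip n a b : is_composition n a ->
  one_orbit n (meander_map a b) -> one_orbit n (meander_map b a).
Proof.
move=> /andP[_ /eqP en] H x y xn yn.
have [||k] := H (block_rev a x) (block_rev a y).
- by rewrite -en block_rev_lt // en.
- by rewrite -en block_rev_lt // en.
move=> e; exists k; rewrite -[y](block_revK a) -e.
elim: k {e} => [|k IH] /=; first by rewrite block_revK.
by rewrite IH.
Qed.

(* On the surviving vertices the reversal of the new top block of size b1 is
   T o B o T; for R0, the reversal of the new bottom block of size 2 b1 - a1 is
   the restriction of T. *)
Lemma one_orbit_step n a b mv a' b' : is_composition n a -> is_composition n b ->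
    step a b mv a' b' -> ~~ is_C0 mv ->
  one_orbit n (meander_map a b) <-> one_orbit (sumn a') (meander_map a' b').
Proof.
move=> ca cb st; have fn := fun x => @meander_map_lt n a b x ca cb.
have fn' := fun x => @meander_map_lt n b a x cb ca.
have fK := meander_mapK b a.
case: st ca cb fn fn' fK => [x xs y ys|c x xs y ys|x xs y ys|x xs y ys|x xs y ys] h;
  [|by []|..] => ca cb fn fn' fK _.
- have -> : sumn (y :: ys) = n by case/andP: cb => _ /eqP.
  by split; apply: one_orbit_flip.
all: have [/andP[/= /andP[x0 _] /eqP en] /andP[/= /andP[y0 _] /eqP em]] := (ca, cb).
all: have fsurj d : d <= n -> forall z, z < d ->
  exists2 t, t < n & meander_map (x :: xs) (y :: ys) t = z.
1, 3, 5: by move=> dn z zd; exists (meander_map (y :: ys) (x :: xs) z); rewrite ?fK ?fn' //; lia.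
(* In each remaining case the deleted segment has the length by which the total drops: [y] for [B0]
   and [P0], [x - y] for [R0]. *)
- have en' : n = y + sumn (y :: xs) by rewrite /= -en; lia.
  rewrite en' in fn fsurj *; apply: one_orbit_first_return => //.
  + by move=> z zy; rewrite /meander_map (@block_rev_head x) 1?(@block_rev_tail y); lia.
  + move=> z zn; rewrite /meander_map; case: (ltnP z y) => zy.
      right; rewrite (@block_rev_head x) 1?(@block_rev_head y ys) ?(@block_rev_head x); try lia.
      rewrite (@block_rev_head y xs) 1?(@block_rev_tail y ys); try lia.
      by split; [lia | congr (_ + block_rev _ _); lia].
    left; rewrite (@block_rev_tail x) 1?(@block_rev_tail y ys); try lia.
    rewrite (@block_rev_tail y xs) //; have -> : y + z - x = z - y by lia.
    by congr (_ + block_rev _ _); lia.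
  + by apply: fsurj; lia.
- have en' : n = (x - y) + sumn (y :: xs) by rewrite /= -en; lia.
  rewrite en' in fn fsurj *; apply: one_orbit_first_return => //.
  + by move=> z zy; rewrite /meander_map (@block_rev_head x) 1?(@block_rev_tail y); lia.
  + move=> z zn; rewrite /meander_map; case: (ltnP z y) => zy.
      (* Here [f (x - y + z) = z], which is a deleted vertex exactly when [z < x - y]. *)
      rewrite (@block_rev_head x _ (_ + _)) 1?(@block_rev_head y ys) ?(@block_rev_head y xs); try lia.
      case: (ltnP z (x - y)) => zd.
        right; split; first by lia.
        rewrite (@block_rev_head x) ?block_rev_tail; try lia.
        rewrite [LHS](_ : _ = y + block_rev ys (x.-1 - z - y)); last first.
          by congr (_ + block_rev _ _); lia.
        by rewrite addnA; congr (_ + block_rev _ _); lia.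
      by left; rewrite block_rev_head; lia.
    left; rewrite (@block_rev_tail x) 1?(@block_rev_tail y ys) ?(@block_rev_tail y xs); try lia.
    rewrite block_rev_tail; last by lia.
    have -> : x - y + z - x = z - y by lia.
    by rewrite addnA; congr (_ + block_rev _ _); lia.
  + by apply: fsurj; lia.
- have en' : n = y + sumn (x - 2 * y :: y :: xs) by rewrite /= -en; lia.
  rewrite en' in fn fsurj *; apply: one_orbit_first_return => //.
  + by move=> z zy; rewrite /meander_map (@block_rev_head x) 1?(@block_rev_tail y); lia.
  + move=> z zn; rewrite /meander_map; case: (ltnP z (x - 2 * y)) => zx.
      left; rewrite (@block_rev_head x) 1?(@block_rev_tail y) 1?(@block_rev_head (x - 2 * y)); try lia.
      by congr (_ + block_rev _ _); lia.
    (* For [x - 2 * y <= z < x - y] the top reversal lands in the first bottom block, so [f] falls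
       into the deleted segment and a second step is needed. *)
    case: (ltnP z (x - y)) => zy.
      right; rewrite (@block_rev_head x) 1?(@block_rev_head y ys) ?(@block_rev_head x); try lia.
      rewrite (@block_rev_tail (x - 2 * y)) 1?(@block_rev_tail y ys) ?(@block_rev_head y xs); try lia.
      by split; [lia | congr (_ + block_rev _ _); lia].
    left; rewrite (@block_rev_tail x) 1?(@block_rev_tail y ys) ?(@block_rev_tail (x - 2 * y)); try lia.
    rewrite (@block_rev_tail y xs); last by lia.
    have -> : y + z - x = z - (x - 2 * y) - y by lia.
    by congr (_ + block_rev _ _); lia.
  + by apply: fsurj; lia.
Qed.

(** The two reversals agree on the common first block and cancel there, so vertex 0 is an orbit by
    itself. *)
Lemma one_orbit_C0 c n a b : is_composition n (c :: a) -> is_composition n (c :: b) ->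
  one_orbit n (meander_map (c :: a) (c :: b)) <-> c = 1 /\ a = [::].
Proof.
rewrite /is_composition /= => /andP[/andP[c0 pa] /eqP <-] _.
have id0 k x : x < c -> iter k (meander_map (c :: a) (c :: b)) x = x.
  move=> xc; elim: k => //= k ->.
  by rewrite /meander_map (block_rev_head a) ?block_rev_head; lia.
split.
  move=> H; have c1 : c = 1.
    have [c2|] := ltnP 1 c; last by lia.
    by have [||k] := H 0 1; rewrite ?id0 //; lia.
  split=> //; case: a pa H id0 => //= d a /andP[d0 _] H id0.
  by have [||k] := H 0 1; rewrite ?id0 //; lia.
case=> -> -> /= x y xn yn; exists 0 => /=; lia.
Qed.

(** Induction along the signature: moves other than [C0] preserve both sides, and a leading [C0]
    forces [s'] to be empty. *)
Lemma one_orbit_signature n a b s : is_composition n a -> is_composition n b ->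
    signature a b s -> 0 < n ->
  one_orbit n (meander_map a b) <->
  (exists2 s', s = rcons s' (C0 1) & ~~ has is_C0 s').
Proof.
move=> ca cb sig; elim: sig n ca cb => {a b s} [|a b mv a' b' s st sig IH] n ca cb n0.
  by move: ca; rewrite /is_composition /=; lia.
have [n' [ca' cb' _]] := step_composition ca cb st.
have [mvC0|mvN] := boolP (is_C0 mv); last first.
  (* Only a [C0] can remove all vertices. *)
  have n'0 : 0 < n'.
    case/andP: ca' => _ /eqP <-.
    by case: st ca cb mvN; rewrite /is_composition /= => *; lia.
  have en : sumn a' = n' by case/andP: ca' => _ /eqP.
  rewrite (one_orbit_step ca cb st mvN) en (IH n' ca' cb' n'0).
  split=> -[s' es Ns].
    by exists (mv :: s'); rewrite ?es //= negb_or mvN.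
  case: s' es Ns => [|mv' s'] /= [emv es]; first by rewrite emv in mvN.
  by rewrite negb_or => /andP[_ Ns]; exists s'.
case: st mvC0 ca cb sig {IH} ca' => // c x xs y ys -> -> _ ca cb sig ca'.
rewrite (one_orbit_C0 ca cb); split.
  case=> -> e; exists [::] => //=.
  (* No move applies to an empty top sequence, so the signature ends here. *)
  by inversion sig as [|? ? ? ? ? ? st]; subst => //; inversion st.
case=> -[|mv' s'] /= [emv es]; last by rewrite -emv.
rewrite emv; split=> //.
by inversion sig as [|]; subst.
Qed.

(** * Frobenius meanders *)

(** The default [x] of [insubd] is never reached when [a] is a composition of [n]. *)
Definition block_rev_ord n (a : seq nat) (x : 'I_n) : 'I_n :=
  insubd x (block_rev a x).

Lemma val_block_rev_ord n a (x : 'I_n) : is_composition n a ->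
  val (block_rev_ord a x) = block_rev a x.
Proof.
by move=> /andP[_ /eqP en]; rewrite val_insubd -{2}en block_rev_lt // en.
Qed.

Lemma block_rev_ordK n a : is_composition n a -> involutive (@block_rev_ord n a).
Proof.
by move=> ca x; apply: val_inj; rewrite !val_block_rev_ord // block_revK.
Qed.

Lemma meander_graphE n a b : is_composition n a -> is_composition n b ->
  forall x y, @meander_graph n a b x y =
    ((x != y) && (block_rev_ord a x == y)) + ((x != y) && (block_rev_ord b x == y)).
Proof.
move=> ca cb x y.
by rewrite /meander_graph !block_edgeE -!val_eqE /= !val_block_rev_ord.
Qed.

Lemma one_orbitP n a b : is_composition n a -> is_composition n b ->
  (forall x y, fconnect (@block_rev_ord n b \o @block_rev_ord n a) x y) <->
  one_orbit n (meander_map a b).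
Proof.
move=> ca cb; set f := _ \o _.
have val_iter k x : val (iter k f x) = iter k (meander_map a b) (val x).
  by elim: k => //= k <-; rewrite !val_block_rev_ord.
split=> [tr x y xn yn|orb x y].
  exists (findex f (Ordinal xn) (Ordinal yn)).
  by rewrite -[x]/(val (Ordinal xn)) -val_iter iter_findex.
have [k e] := orb x y (ltn_ord x) (ltn_ord y).
suff -> : y = iter k f x by apply: fconnect_iter.
by apply: val_inj; rewrite val_iter.
Qed.

(** Index 0 means [2 * C + P = 1], which for natural numbers forces [C = 0] and [P = 1]. *)
Lemma frobeniusP n a b : 0 < n -> is_composition n a -> is_composition n b ->
  frobenius n a b <-> one_orbit n (meander_map a b).
Proof.
move=> n0 ca cb; rewrite -one_orbitP //.
rewrite -(unique_path_component_iff (Ordinal n0) (block_rev_ordK ca)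
  (block_rev_ordK cb) (meander_graphE ca cb)).
rewrite /frobenius /meander_index; lia.
Qed.

Theorem theorem4 (n : nat) (a b : seq nat) (s : seq move) (n_gt0 : 0 < n)
    (a_comp : is_composition n a) (b_comp : is_composition n b)
    (s_sig : signature a b s) :
  frobenius n a b <->
  (exists2 s' : seq move, s = rcons s' (C0 1) & ~~ has is_C0 s').
Proof.
by rewrite frobeniusP // (one_orbit_signature a_comp b_comp s_sig).
Qed.
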